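(* Let $R_0,R_1,R_2\in\mathbb{C}^{n,n}$ be Hermitian positive semi-definite and let $J\in\mathbb{C}^{n,n}$ be skew-Hermitian. Assume that $\ker R_0\cap\ker R_1\cap\ker R_2\cap\ker J=\{0\}$. Then the bivariate matrix polynomial $\tilde P(z_1,z_2)=z_1z_2R_2+z_2(J+R_1)+R_0$ is stable with respect to $H_{\pi/2}^2$, the Cartesian square of the open right half-plane. In consequence, $P(\lambda)=\lambda^2R_2+\lambda(J+R_1)+R_0$ is a regular matrix polynomial, hyperstable with respect to $H_{\pi/2}$.
   Context: $H_{\pi/2}=\{\lambda\in\mathbb{C}:\operatorname{Im}(\lambda e^{\mathrm{i}\pi/2})>0\}=\{\lambda\in\mathbb{C}:\operatorname{Re}\lambda>0\}$. A bivariate matrix polynomial $Q(z_1,z_2)\in\mathbb{C}^{n,n}[z_1,z_2]$ is stable with respect to a nonempty set $\Omega\subseteq\mathbb{C}^2$ if for all $(w_1,w_2)\in\Omega$ and all $x\in\mathbb{C}^n\setminus\{0\}$ there exists $y\in\mathbb{C}^n\setminus\{0\}$ with $y^*Q(w_1,w_2)x\neq0$ (equivalently, $\det Q(w_1,w_2)\neq0$ on $\Omega$). A matrix polynomial $P(\lambda)\in\mathbb{C}^{n,n}[\lambda]$ is regular if $\det P(\lambda)\not\equiv0$. A regular $P(\lambda)$ is hyperstable with respect to a nonempty open or closed $D\subseteq\mathbb{C}$ if for every $x\in\mathbb{C}^n\setminus\{0\}$ there exists $y\in\mathbb{C}^n\setminus\{0\}$ such that $y^*P(\mu)x\neq0$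 for all $\mu\in D$. *)

(* Defs.v *)
From HB Require Import structures.
From mathcomp Require Import all_boot all_order all_algebra.
From mathcomp Require Import all_classical all_reals all_analysis.
From mathcomp Require Import complex.

Set Implicit Arguments.
Unset Strict Implicit.
Unset Printing Implicit Defensive.

Import Order.TTheory GRing.Theory Num.Theory.
Import numFieldNormedType.Exports.

Local Open Scope classical_set_scope.
Local Open Scope ring_scope.
Local Open Scope complex_scope.
Local Open Scope sesquilinear_scope.

Section Definitions.
Variables (R : realType) (n : nat).
Local Notation C := R[i].

(* The order on R[i] is partial: 0 <= z says that z is real and nonnegative. *)
Definition hermitian_psd (A : 'M[C]_n) : Prop :=
  A \is hermsymmx /\ forall x : 'cV[C]_n, 0 <= (x^t* *m A *m x) 0 0.

Definition skew_hermitian (A : 'M[C]_n) : Prop := A^t* = - A.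

Definition mxker (A : 'M[C]_n) : set 'cV[C]_n := [set x | A *m x = 0].

(* C^{n,n}[z] and C^{n,n}[z1, z2] are encoded as matrices with polynomial
   entries, since 'M[C]_n has no ring structure suitable for {poly _} when n is
   a variable. In the bivariate case z1 is 'X and z2 is 'Y. *)
Definition mxconst (A : 'M[C]_n) : 'M[{poly C}]_n := map_mx polyC A.
Definition mxconst2 (A : 'M[C]_n) : 'M[{poly {poly C}}]_n :=
  map_mx (fun a => a%:P%:P) A.

Definition mxeval (P : 'M[{poly C}]_n) (z : C) : 'M[C]_n :=
  map_mx (fun p => p.[z]) P.
Definition mxeval2 (Q : 'M[{poly {poly C}}]_n) (z1 z2 : C) : 'M[C]_n :=
  map_mx (fun q => q.[z1, z2]) Q.

Definition stable2 (Omega : set (C * C)) (Q : 'M[{poly {poly C}}]_n) : Prop :=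
  Omega !=set0 /\
  forall w, Omega w -> forall x : 'cV[C]_n, x != 0 ->
    exists2 y : 'cV[C]_n, y != 0 & (y^t* *m mxeval2 Q w.1 w.2 *m x) 0 0 != 0.

Definition regular_mxpoly (P : 'M[{poly C}]_n) : Prop := \det P != 0.

(* R[i]^o is R[i] with the topology of its norm. *)
Definition hyperstable (D : set C) (P : 'M[{poly C}]_n) : Prop :=
  [/\ regular_mxpoly P, D !=set0,
      open (D : set C^o) \/ closed (D : set C^o) &
      forall x : 'cV[C]_n, x != 0 ->
        exists2 y : 'cV[C]_n, y != 0 &
          forall mu, D mu -> (y^t* *m mxeval P mu *m x) 0 0 != 0].

End Definitions.

Definition halfplane (R : realType) (phi : R) : set R[i] :=
  [set z | 0 < complex.Im (z * (cos phi +i* sin phi))].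

Lemma halfplane_pihalf (R : realType) :
  halfplane (pi / 2) = [set z : R[i] | 0 < complex.Re z].
Proof.
apply/seteqP; split => -[a b];
  by rewrite /halfplane /= cos_pihalf sin_pihalf mulr0 mulr1 addr0.
Qed.

(* Main.v *)
Require Import Defs.
From mathcomp Require Import all_boot all_order all_algebra.
From mathcomp Require Import all_classical all_reals all_analysis.
From mathcomp Require Import complex.
From mathcomp Require Import ring.
Import Order.TTheory GRing.Theory Num.Theory.
Import numFieldNormedType.Exports.
Local Open Scope classical_set_scope.
Local Open Scope ring_scope.
Local Open Scope sesquilinear_scope.

(** Fix x <> 0 and write r_k = x^* R_k x >= 0 and j = x^* J x, which is purely
    imaginary. Dividing z1 z2 r2 + z2 (j + r1) + r0 by z2 and taking real parts
    gives Re z1 r2 + r1 + Re (1 / z2) r0, which is positive on the product of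
    half-planes unless r0 = r1 = r2 = 0; so y = x works except in that case.
    There semi-definiteness yields R_k x = 0 for all k, so that the polynomial
    applied to x is z2 J x with J x <> 0, and y = J x works. Since y does not
    depend on (z1, z2), restricting to z1 = z2 gives hyperstability. *)

Lemma adj_mul (C : numClosedFieldType) m n p (A : 'M[C]_(m, n))
    (B : 'M[C]_(n, p)) : (A *m B)^t* = B^t* *m A^t*.
Proof. by rewrite trmx_mul map_mxM. Qed.

(** For [y = x] and [A] skew-Hermitian, this makes the form purely imaginary. *)
Lemma form_conj (C : numClosedFieldType) n (A : 'M[C]_n) (x y : 'cV[C]_n) :
  ((y^t* *m A *m x) 0 0)^* = (x^t* *m A^t* *m y) 0 0.
Proof.
have -> : x^t* *m A^t* *m y = (y^t* *m A *m x)^t*.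
  by rewrite !adj_mul trmxCK mulmxA.
by rewrite !mxE.
Qed.

Lemma sqnorm_gt0 (C : numClosedFieldType) n (x : 'cV[C]_n) :
  x != 0 -> 0 < (x^t* *m x) 0 0.
Proof.
(* [dotmx] pairs row vectors, so it is applied to [x^T]; its summands are those of [x^* x] with the
   factors swapped. *)
move=> x0; have xt0 : x^T != 0 by rewrite -(inj_eq trmx_inj) trmxK trmx0.
have := dotmx_is_dotmx xt0; rewrite dotmxE trmxK.
by rewrite mxE [X in _ -> _ < X]mxE; under eq_bigr do rewrite !mxE mulrC;
  under [X in _ -> _ < X]eq_bigr do rewrite !mxE.
Qed.

Lemma psd_form_eq0 (C : numClosedFieldType) n (A : 'M[C]_n) (x : 'cV[C]_n) :
  A^t* = A -> (forall y : 'cV[C]_n, 0 <= (y^t* *m A *m y) 0 0) ->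
  (x^t* *m A *m x) 0 0 = 0 -> A *m x = 0.
Proof.
move=> hA pA xAx0; apply/eqP/negPn/negP => /sqnorm_gt0.
set w := A *m x; set N := (w^t* *m w) 0 0 => N_gt0.
set c := (w^t* *m A *m w) 0 0; have c_ge0 : 0 <= c by exact: pA.
have c1_gt0 : 0 < c + 1 by rewrite ltr_wpDl.
(* A small step from x in the direction -Ax would make the form negative. *)
pose t := N / (c + 1).
have t_real : t^* = t by apply: conj_Creal; rewrite gtr0_real ?divr_gt0.
have wAx : (w^t* *m A *m x) 0 0 = N by rewrite -mulmxA.
have xAw : (x^t* *m A *m w) 0 0 = N.
  by rewrite -[A]hA -adj_mul.
have := pA (x - t *: w).
have -> : ((x - t *: w)^t* *m A *m (x - t *: w)) 0 0 =
    - (t * N) *+ 2 + t ^+ 2 * c.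
  have -> : (x - t *: w)^t* = x^t* - t *: w^t*.
    by apply/matrixP => i j; rewrite !mxE rmorphB rmorphM /= t_real.
  rewrite mulmxBl mulmxBr !mulmxBl -!scalemxAl -!scalemxAr.
  move: xAx0 wAx xAw; rewrite /c => e1 e2 e3.
  by rewrite !(e1, e2, e3, mxE) -/c; ring.
(* The quadratic in [t] has its minimum at [N / c]. The denominator [c + 1] allows [c = 0], and
   [t * c = N - t] still makes the value negative. *)
have -> : - (t * N) *+ 2 + t ^+ 2 * c = - (t * N * (1 + (c + 1)^-1)).
  by rewrite /t; field; rewrite gt_eqF.
rewrite oppr_ge0 => /le_gtF/negP; apply.
by rewrite !mulr_gt0 ?invr_gt0 // addr_gt0 ?invr_gt0.
Qed.

Lemma scalar_stable (C : numClosedFieldType) (z1 z2 r0 r1 r2 j : C) :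
  0 < 'Re z1 -> 0 < 'Re z2 -> 0 <= r0 -> 0 <= r1 -> 0 <= r2 -> j^* = - j ->
  z1 * z2 * r2 + z2 * (j + r1) + r0 = 0 -> [/\ r0 = 0, r1 = 0 & r2 = 0].
Proof.
move=> z1_gt0 z2_gt0 r0_ge0 r1_ge0 r2_ge0 j_imag eq0.
have z2_neq0 : z2 != 0 by apply: contraTneq z2_gt0 => ->; rewrite raddf0 ltxx.
have N_gt0 : 0 < `|z2| ^+ 2 by rewrite exprn_gt0 ?normr_gt0.
have re_j : 'Re j = 0 by rewrite ReE j_imag subrr mul0r.
(* Multiplying by [z2^*] is division by [z2] up to the positive factor [|z2|^2], and avoids
   inverses. *)
have /(congr1 (fun z => 'Re (z2^* * z))) := eq0; rewrite mulr0 raddf0 /=.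
have -> : z2^* * (z1 * z2 * r2 + z2 * (j + r1) + r0) =
    (`|z2| ^+ 2 * r2) * z1 + `|z2| ^+ 2 * j + (`|z2| ^+ 2 * r1) + r0 * z2^*.
  by rewrite normCK; ring.
have Nr2_real : `|z2| ^+ 2 * r2 \is Num.real
  by rewrite ger0_real ?mulr_ge0 ?(ltW N_gt0).
have Nr1_ge0 : 0 <= `|z2| ^+ 2 * r1 by rewrite mulr_ge0 // ltW.
rewrite !raddfD /= (ReMl Nr2_real) (ReMl (ger0_real (ltW N_gt0)) j).
rewrite (ReMl (ger0_real r0_ge0)) Re_conj re_j mulr0 addr0.
rewrite (Creal_ReP _ (ger0_real Nr1_ge0)).
have a_ge0 : 0 <= `|z2| ^+ 2 * r2 * 'Re z1 by rewrite !mulr_ge0 // ltW.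
have d_ge0 : 0 <= r0 * 'Re z2 by rewrite mulr_ge0 // ltW.
(* Three nonnegative terms sum to zero, so each vanishes; the factors ['Re z1], ['Re z2] and [|z2|]
   are nonzero and cancel. *)
move/eqP; rewrite paddr_eq0 ?addr_ge0 // paddr_eq0 // !mulf_eq0.
rewrite (gt_eqF z1_gt0) (gt_eqF z2_gt0) normr_eq0 (negPf z2_neq0) !orbF /=.
by case/andP=> /andP[/eqP-> /eqP->] /eqP->.
Qed.

(** Links [complex.Re], valued in [R], to ['Re], valued in [R[i]]. *)
Lemma halfplane_pihalf_gt0 (R : realType) (z : R[i]) :
  halfplane (pi / 2) z <-> 0 < 'Re z.
Proof. by rewrite halfplane_pihalf /= -complexRe ltcR. Qed.

Lemma open_halfplane_pihalf (R : realType) :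
  open (halfplane (pi / 2 : R) : set R[i]^o).
Proof.
(* The ball of radius ['Re z] around [z] fits, because ['Re (z - w) <= |z - w|]. *)
rewrite openE => z /halfplane_pihalf_gt0 z_gt0.
apply/nbhs_ballP; exists ('Re z) => //= w /= zw.
apply/halfplane_pihalf_gt0.
have Re_lt : 'Re (z - w) < 'Re z.
  by apply: le_lt_trans zw; have [] := leif_Re_Creal (z - w).
by move: Re_lt; rewrite raddfB /= ltrBlDl ltrDr.
Qed.

Lemma hermitian_psd_ker (R : realType) n (A : 'M[R[i]]_n) (x : 'cV[R[i]]_n) :
  hermitian_psd A -> (x^t* *m A *m x) 0 0 = 0 -> A *m x = 0.
Proof.
move=> [/is_hermitianmxP hA pA]; apply: psd_form_eq0 pA.
by rewrite [RHS]hA expr0 scale1r.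
Qed.

Lemma uniform_witness (R : realType) n (R0 R1 R2 J : 'M[R[i]]_n)
    (x : 'cV[R[i]]_n) :
  hermitian_psd R0 -> hermitian_psd R1 -> hermitian_psd R2 ->
  skew_hermitian J ->
  mxker R0 `&` mxker R1 `&` mxker R2 `&` mxker J = [set 0] -> x != 0 ->
  exists2 y : 'cV[R[i]]_n, y != 0 &
    forall z1 z2 : R[i], 0 < 'Re z1 -> 0 < 'Re z2 ->
    (y^t* *m ((z1 * z2) *: R2 + z2 *: (J + R1) + R0) *m x) 0 0 != 0.
Proof.
move=> hR0 hR1 hR2 hJ hker x0.
have formE (y : 'cV[R[i]]_n) z1 z2 :
    (y^t* *m ((z1 * z2) *: R2 + z2 *: (J + R1) + R0) *m x) 0 0 =
    z1 * z2 * (y^t* *m R2 *m x) 0 0 +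
    z2 * ((y^t* *m J *m x) 0 0 + (y^t* *m R1 *m x) 0 0) +
    (y^t* *m R0 *m x) 0 0.
  rewrite !mulmxDr -!scalemxAr !mulmxDr !mulmxDl -!scalemxAl !mulmxDl.
  move: (_ *m R2 *m x) (_ *m J *m x) (_ *m R1 *m x) (_ *m R0 *m x) => a b c d.
  by rewrite !mxE.
have [[f0 f1 f2]|nz] := pselect [/\ (x^t* *m R0 *m x) 0 0 = 0,
  (x^t* *m R1 *m x) 0 0 = 0 & (x^t* *m R2 *m x) 0 0 = 0].
- have k0 := hermitian_psd_ker _ _ _ _ hR0 f0.
  have k1 := hermitian_psd_ker _ _ _ _ hR1 f1.
  have k2 := hermitian_psd_ker _ _ _ _ hR2 f2.
  have Jx0 : J *m x != 0.
    apply: contraNneq x0 => Jx; apply/eqP.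
    by suff: [set 0] x by []; rewrite -hker; do !split.
  exists (J *m x) => // w1 w2 _ w2_gt0.
  (* Only [w2] times the squared norm of [J *m x] survives. *)
  rewrite formE -!mulmxA k0 k1 k2 !mulmx0 [X in _ * (_ + X)]mxE.
  rewrite [X in _ * X + _]mxE [X in _ + X]mxE mulr0 add0r !addr0.
  rewrite mulf_neq0 //; last by rewrite gt_eqF // sqnorm_gt0.
  by apply: contraTneq w2_gt0 => ->; rewrite raddf0 ltxx.
- exists x => // w1 w2 w1_gt0 w2_gt0; rewrite formE.
  apply/eqP => e; apply: nz; apply: scalar_stable e => //.
  + exact: hR0.2.
  + exact: hR1.2.
  + exact: hR2.2.
  + by rewrite form_conj hJ mulmxN mulNmx [LHS]mxE.
Qed.

Theorem theorem7p5 (R : realType) (n : nat) (R0 R1 R2 J : 'M[R[i]]_n)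
    (hR0 : hermitian_psd R0) (hR1 : hermitian_psd R1)
    (hR2 : hermitian_psd R2) (hJ : skew_hermitian J)
    (hker : mxker R0 `&` mxker R1 `&` mxker R2 `&` mxker J = [set 0]) :
  let Ptilde := ('X * 'Y) *: mxconst2 R2 + 'Y *: mxconst2 (J + R1)
                + mxconst2 R0 in
  let P := 'X^2 *: mxconst R2 + 'X *: mxconst (J + R1) + mxconst R0 in
  let H := halfplane (pi / 2 : R) in
  [/\ stable2 (H `*` H) Ptilde, regular_mxpoly P & hyperstable H P].
Proof.
move=> Ptilde P H.
have witness x := uniform_witness _ _ _ _ _ _ x hR0 hR1 hR2 hJ hker.
have PtildeE z1 z2 :
    mxeval2 Ptilde z1 z2 = (z1 * z2) *: R2 + z2 *: (J + R1) + R0.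
  by apply/matrixP => i j; rewrite !mxE !hornerE.
(* [P] is [Ptilde] restricted to the diagonal [z1 = z2]. *)
have PE z : mxeval P z = (z * z) *: R2 + z *: (J + R1) + R0.
  by apply/matrixP => i j; rewrite !mxE !hornerE expr2.
have Re1 : 0 < 'Re (1 : R[i]) by rewrite (Creal_ReP _ _) ?rpred1.
have H1 : H 1 by apply/halfplane_pihalf_gt0.
have P_regular : regular_mxpoly P.
  rewrite /regular_mxpoly; apply/eqP => detP0.
  (* If [\det P] were zero, [P] would be singular at 1, against the witness at [z1 = z2 = 1]. The
     transpose is there because [det0P] yields a left kernel vector. *)
  have /eqP/det0P[v v0 vP] : \det (mxeval P 1)^T = 0.
    rewrite det_tr; have <- : map_mx (horner_eval 1) P = mxeval P 1.
      by apply/matrixP => i j; rewrite !mxE.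
    by rewrite det_map_mx detP0 raddf0.
  have vt0 : v^T != 0 by rewrite -(inj_eq trmx_inj) trmxK trmx0.
  have [y _ /(_ 1 1 Re1 Re1)] := witness _ vt0.
  rewrite -PE -mulmxA -[mxeval P 1 in X in X -> _]trmxK -trmx_mul vP.
  by rewrite trmx0 mulmx0 mxE eqxx.
split=> //.
- split; first by exists (1, 1).
  move=> [w1 w2] /= [/halfplane_pihalf_gt0 w1H /halfplane_pihalf_gt0 w2H] x.
  by move=> /witness[y y0 yP]; exists y; rewrite // PtildeE yP.
- split=> //; [by exists 1|by left; exact: open_halfplane_pihalf|].
  move=> x /witness[y y0 yP]; exists y => // mu /halfplane_pihalf_gt0 muH.
  by rewrite PE yP.
Qed.
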